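(* Let $G$ be a connected graph with $n(G)\ge 2$, and let $H$ be a graph with $\mathrm{diam}(H)=2$ and $o(H)=\mathcal{R}$. Then $$R_{\rm MB}(G\odot H)\le R_{\rm MB}'(G\odot H)\le n(G)\,R_{\rm MB}'(H).$$ If, in addition, $R_{\rm MB}(H)=R_{\rm MB}'(H)$, then $$R_{\rm MB}(G\odot H)=R_{\rm MB}'(G\odot H)=n(G)\,R_{\rm MB}(H).$$
   Context: All graphs are finite and simple; $n(X)=|V(X)|$, and $\mathrm{diam}(X)$ is the largest shortest-path distance between two vertices of $X$. The corona product $G\odot H$ of a connected graph $G$ and a graph $H$ is obtained from one copy of $G$ and $n(G)$ disjoint copies of $H$ by joining the $i$-th vertex of $G$ to every vertex of the $i$-th copy of $H$. A set $W\subseteq V(X)$ of a connected graph $X$ is a resolving set of $X$ if for every two distinct vertices $x,y$ of $X$ there is $z\in W$ such that the shortest-path distances $d_X(x,z)$ and $d_X(y,z)$ differ. The Maker-Breaker resolving game on a connected graph $X$ is played by two players, Resolver and Spoiler, who alternately select a not yet played vertex of $X$. Resolver wins if he selects all the vertices of some resolving set of $X$; Spoiler wins if she prevents this, i.e. if she selects at least one vertex from every resolving set of $X$. In the R-game Resolver moves first; in the S-game Spoiler moves first. The outcome $o(X)$ is: $\mathcal{R}$ if Resolver has a winning strategy no matter who starts the game; $\mathcal{S}$ if Spoiler has a winning strategy no matter who starts the game; $\mathcal{N}$ if the first player has a winning strategy (no matter which of the two players that is). The Maker-Breaker resolving number $R_{\rm MB}(X)$ is the minimum number of moves of Resolver to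 win the R-game on $X$ when both players play optimally (Resolver to win as fast as possible, Spoiler to delay this as long as possible); $R_{\rm MB}'(X)$ is the corresponding number of moves of Resolver for the S-game. (When $o(X)=\mathcal{R}$ both numbers are well defined.) *)

(* Defs.v *)
From mathcomp Require Import all_boot.
From mathcomp Require Import boolp.

Set Implicit Arguments.
Unset Strict Implicit.
Unset Printing Implicit Defensive.

(** * Finite simple graphs *)

Record sgraph := SGraph {
  vertex :> finType;
  adj : rel vertex;
  adj_sym : symmetric adj;
  adj_irrefl : irreflexive adj }.

Arguments adj {s}.

Definition connected (X : sgraph) : bool :=
  [forall x : X, forall y : X, connect adj x y].

Definition has_path (X : sgraph) (x y : X) (k : nat) : bool :=
  [exists p : k.-tuple X, [&& path adj x p, last x p == y & uniq (x :: p)]].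

(** A path has fewer than [#|X|] edges, so the search range is exhaustive; the
    value is [#|X|] exactly when [x] and [y] lie in different components. *)
Definition dist (X : sgraph) (x y : X) : nat :=
  find (has_path x y) (iota 0 #|X|).

(** [None] is the infinite diameter of a disconnected graph. *)
Definition diam (X : sgraph) : option nat :=
  if connected X then Some (\max_(x : X) \max_(y : X) dist x y) else None.

Definition resolving (X : sgraph) (W : {set X}) : bool :=
  [forall x : X, forall y : X,
    (x != y) ==> [exists z in W, dist x z != dist y z]].

(** * Corona product

    [inl g] is the vertex [g] of [G]; [inr (g, h)] is the vertex [h] of the
    copy of [H] attached to [g]. *)

Definition corona_adj (G H : sgraph) : rel (G + G * H)%type :=
  fun u v => match u, v with
  | inl g, inl g' => adj g g'
  | inl g, inr (g', _) => g == g'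
  | inr (g, _), inl g' => g == g'
  | inr (g, h), inr (g', h') => (g == g') && adj h h'
  end.

Lemma corona_adj_sym (G H : sgraph) : symmetric (@corona_adj G H).
Proof.
by case=> [g|[g h]] [g'|[g' h']] //=; rewrite ?(eq_sym g g') 1?adj_sym.
Qed.

Lemma corona_adj_irrefl (G H : sgraph) : irreflexive (@corona_adj G H).
Proof. by case=> [g|[g h]] /=; rewrite adj_irrefl ?andbF. Qed.

Definition corona (G H : sgraph) : sgraph :=
  SGraph (@corona_adj_sym G H) (@corona_adj_irrefl G H).

(** * The Maker-Breaker resolving game *)

Variant player := Resolver | Spoiler.

Definition opponent (P : player) : player :=
  if P is Resolver then Spoiler else Resolver.

Definition same_player (P Q : player) : bool :=
  match P, Q with
  | Resolver, Resolver | Spoiler, Spoiler => true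
  | _, _ => false
  end.

Section Game.
Variable X : sgraph.
Implicit Types (P first : player) (s h : seq X).

(** A play is recorded as the sequence of the selected vertices, in order; it
    is carried on until every vertex is selected, which does not affect who
    wins, nor after how many moves. *)
Definition full_play s : Prop := uniq s /\ forall x : X, x \in s.

Definition to_move first h : player := iter (size h) opponent first.

Fixpoint selected P first s : seq X :=
  if s is x :: s' then
    let rest := selected P (opponent first) s' in
    if same_player P first then x :: rest else rest
  else [::].

(** A strategy maps the sequence of the vertices played so far to the vertex
    to be selected next. *)
Definition strategy := seq X -> X.

Definition legal (sigma : strategy) : Prop :=
  forall h, (exists y, y \notin h) -> sigma h \notin h.

Definition follows P first (sigma : strategy) s : Prop :=
  forall h x, prefix (rcons h x) s -> to_move first h = P -> x = sigma h.

Definition guarantees P first (sigma : strategy) (goal : seq X -> Prop) : Prop :=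
  legal sigma /\ forall s, full_play s -> follows P first sigma s -> goal s.

Definition won_by P first s : Prop :=
  match P with
  | Resolver =>
      exists2 W : {set X}, resolving W & {subset W <= selected Resolver first s}
  | Spoiler =>
      forall W : {set X}, resolving W ->
        exists2 z, z \in W & z \in selected Spoiler first s
  end.

Definition has_winning_strategy P first : Prop :=
  exists sigma, guarantees P first sigma (won_by P first).

Definition resolver_won_within first (k : nat) s : Prop :=
  exists2 W : {set X},
    resolving W & {subset W <= take k (selected Resolver first s)}.

Definition resolver_wins_within first (k : nat) : Prop :=
  exists sigma, guarantees Resolver first sigma (resolver_won_within first k).

(** The least [k] such that Resolver can force a win within [k] of his own
    moves, i.e. the minimax number of his moves; the value [0] is a dummy if
    he cannot force a win at all. *)
Definition resolver_moves first : nat :=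
  if pselect (exists k, `[< resolver_wins_within first k >]) is left ex
  then ex_minn ex else 0.

End Game.

Variant outcome_class := outcome_R | outcome_S | outcome_N.

Definition has_outcome (X : sgraph) (o : outcome_class) : Prop :=
  match o with
  | outcome_R => forall first, has_winning_strategy X Resolver first
  | outcome_S => forall first, has_winning_strategy X Spoiler first
  | outcome_N => forall first, has_winning_strategy X first first
  end.

Definition RMB (X : sgraph) : nat := resolver_moves X Resolver.
Definition RMB' (X : sgraph) : nat := resolver_moves X Spoiler.

(* Main.v *)
Require Import Defs.
From mathcomp Require Import all_boot.
From mathcomp Require Import boolp zify.

(** Vertices outside a copy of [H] do not tell apart the vertices of that copy,
    and distances inside it are those of [H] because [diam H = 2]. Hence a set
    resolves the corona iff it meets every copy in a resolving set of [H], and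
    the game on the corona is the disjoint union of the games on the copies
    together with irrelevant moves in [G]. Either player can then answer in the
    copy where the opponent has just played: this yields [RMB' <= n RMB'(H)] for
    Resolver, and [RMB >= n RMB(H)] for Spoiler. *)

Set Implicit Arguments.
Unset Strict Implicit.
Unset Printing Implicit Defensive.

(** * Distances *)

Section Distance.
Variable X : sgraph.
Implicit Types (x y z : X) (p : seq X).

Lemma has_pathP x y k :
  reflect (exists p, [/\ size p = k, path adj x p, last x p = y & uniq (x :: p)])
          (has_path x y k).
Proof.
apply: (iffP existsP) => [[t /and3P[pt /eqP lt ut]]|[p [sp pp lp up]]].
  by exists t; split=> //; rewrite size_tuple.
move/eqP: sp => sp; exists (Tuple sp) => /=.
by rewrite pp lp eqxx; move: up => /= ->.
Qed.

Lemma uniq_path_lt_card x p : uniq (x :: p) -> size p < #|X|.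
Proof. by move=> /card_uniqP up; have := max_card (mem (x :: p)); rewrite up. Qed.

Lemma dist_le_walk x p : path adj x p -> dist x (last x p) <= size p.
Proof.
move=> /shortenP[q pq uq sq].
have {}sq : size q <= size p.
  by apply: uniq_leq_size sq; have /andP[] := uq.
have ltq := uniq_path_lt_card uq; apply: leq_trans sq; rewrite leqNgt; apply/negP => lt.
have := before_find 0 lt; rewrite nth_iota // add0n => no.
suff: has_path x (last x q) (size q) by rewrite no.
by apply/has_pathP; exists q.
Qed.

Lemma geodesic x y : connected X ->
  exists p, [/\ size p = dist x y, path adj x p & last x p = y].
Proof.
move=> /forallP/(_ x)/forallP/(_ y)/connectP[p pp ->] {y}.
have: has (has_path x (last x p)) (iota 0 #|X|).
  case/shortenP: pp => q pq uq _; apply/hasP; exists (size q).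
    by rewrite mem_iota add0n (uniq_path_lt_card uq).
  by apply/has_pathP; exists q.
move=> hp; have := nth_find 0 hp; move: hp; rewrite has_find size_iota => lt.
by rewrite nth_iota // add0n => /has_pathP[q [sq pq lq _]]; exists q.
Qed.

Lemma distxx x : dist x x = 0.
Proof. by apply/eqP; rewrite -leqn0; apply: (@dist_le_walk x [::]). Qed.

Lemma dist_eq0 x y : connected X -> (dist x y == 0) = (x == y).
Proof.
move=> cX; apply/eqP/eqP => [d0|->]; last exact: distxx.
by have [[|? ?] []] := geodesic x y cX; rewrite ?d0.
Qed.

Lemma dist_adj x y z : connected X -> adj x y -> dist x z <= (dist y z).+1.
Proof.
move=> cX xy; have [p [<- pp <-]] := geodesic y z cX.
by apply: (@dist_le_walk x (y :: p)); rewrite /= xy.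
Qed.

Lemma dist_descent x z : connected X -> x != z ->
  exists2 y, adj x y & dist y z < dist x z.
Proof.
move=> cX; have [[|y p] [<- /= + <-]] := geodesic x z cX; first by rewrite eqxx.
by move=> /andP[xy pp] _; exists y => //; apply: dist_le_walk.
Qed.

(* A function that changes by at most one along each edge and can always be
   decreased away from [z] is the distance to [z]. *)
Lemma dist_eq (f : X -> nat) z :
    f z = 0 -> (forall x y, adj x y -> f x <= (f y).+1) ->
    (forall x, x != z -> exists2 y, adj x y & f y < f x) ->
  forall x, dist x z = f x.
Proof.
move=> fz lip desc x.
(* The Lipschitz condition makes every walk from [y] to [z] at least [f y] long. *)
have lower p y : path adj y p -> f y <= f (last y p) + size p.
  elim: p y => [|a p IH] y /=; first by rewrite addn0.
  by move=> /andP[/lip ya /IH]; lia.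
(* Repeated descent reaches [z]; by the Lipschitz condition each step lowers [f] by exactly one. *)
have [p [pp lp sp up]] : exists p,
    [/\ path adj x p, last x p = z, size p = f x
      & sorted (fun u v => f v < f u) (x :: p)].
  have [n] := ubnP (f x); elim: n x => // n IH x lt.
  have [->|/desc[y xy yx]] := eqVneq x z; first by exists [::].
  have [|p [pp lp sp up]] := IH y; first by lia.
  have := lip _ _ xy => lxy.
  by exists (y :: p); split; rewrite //= ?xy ?yx ?sp //; lia.
(* Strict decrease makes the vertices distinct, so the length of [p] lies in the search range of
   [dist]. *)
have {}up : uniq (x :: p).
  apply: (sorted_uniq _ _ up) => [u v w|u] /=; last exact: ltnn.
  by move=> h1 h2; apply: ltn_trans h2 h1.
apply/eqP; rewrite eqn_leq -{1}lp -sp dist_le_walk //= leqNgt; apply/negP => lt.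
have ltn : dist x z < #|X| by apply: ltn_trans lt (uniq_path_lt_card up).
have: has (has_path x z) (iota 0 #|X|) by rewrite has_find size_iota.
move/(nth_find 0); rewrite -/(dist x z) nth_iota // add0n.
by move=> /has_pathP[q [sq /lower + lq _]]; rewrite lq fz; lia.
Qed.

End Distance.

(** * Resolving sets and graphs of diameter 2 *)

Section Resolving.
Variable X : sgraph.
Implicit Types W : {set X}.

Lemma resolvingP W :
  reflect (forall x y, x != y -> exists2 z, z \in W & dist x z != dist y z)
          (resolving W).
Proof.
apply: (iffP forallP) => [rW x y xy|rW x].
  by move/forallP: (rW x) => /(_ y); rewrite xy => /exists_inP.
by apply/forallP => y; apply/implyP => xy; apply/exists_inP/rW.
Qed.

Lemma resolvingS W W' : W \subset W' -> resolving W -> resolving W'.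
Proof.
move=> /subsetP sW /resolvingP rW; apply/resolvingP => x y /rW[z zW d].
by exists z; first exact: sW.
Qed.

End Resolving.

Lemma diam_Some2 (X : sgraph) : diam X = Some 2 ->
  [/\ connected X, forall x y : X, dist x y <= 2 & exists x y : X, x != y].
Proof.
rewrite /diam; case: ifP => // cX [d2]; split=> // [x y|].
  rewrite -d2; apply: leq_trans (leq_bigmax_cond _ (erefl : xpredT x)).
  exact: (leq_bigmax_cond _ (erefl : xpredT y)).
(* Without two distinct vertices both maxima would be 0. *)
apply: contrapT => one; move: d2; rewrite big1 // => x _.
rewrite big1 // => y _; have [->|xy] := eqVneq x y; first exact: distxx.
by case: one; exists x, y.
Qed.

(** * Resolving sets of corona products *)

Section Corona.
Variables G H : sgraph.
Hypothesis G_connected : connected G.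
Hypothesis H_diam : diam H = Some 2.
Local Notation C := (corona G H).

Lemma dist_corona_inr (g0 : G) (h0 : H) (x : C) :
  dist x (inr (g0, h0) : C) =
  match x with
  | inl g => (dist g g0).+1
  | inr (g, h) => if g == g0 then dist h h0 else (dist g g0).+2
  end.
Proof.
have [cH le2 _] := diam_Some2 H_diam.
apply: (@dist_eq C (fun x => match x with
  | inl g => (dist g g0).+1
  | inr (g, h) => if g == g0 then dist h h0 else (dist g g0).+2 end)).
- by rewrite eqxx distxx.
- case=> [g|[g h]] [g'|[g' h']] /=.
  + by move=> /(dist_adj g0 G_connected).
  + by move=> /eqP <-; case: eqP => [->|_]; rewrite ?distxx; lia.
  (* The detour through [g0] has length 2, so it never beats [dist h h0]: this is where diameter 2
     enters. *)
  + by move=> /eqP <-; have := le2 h h0; case: eqP => [->|_]; rewrite ?distxx; lia.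
  + by move=> /andP[/eqP <- /(dist_adj h0 cH)]; case: eqP; lia.
- case=> [g|[g h]].
  + move=> _; have [->|/(dist_descent G_connected)[g' gg' lt]] := eqVneq g g0.
      by exists (inr (g0, h0)); rewrite /= ?eqxx ?distxx.
    by exists (inl g').
  + move=> ne; case: eqP => [e|_]; last by exists (inl g) => /=.
    have /(dist_descent cH)[h' hh' lt] : h != h0.
      by apply: contra_neq ne => ->; rewrite e.
    by exists (inr (g0, h')); rewrite /= ?e ?eqxx.
Qed.

Lemma dist_corona_inl (g0 : G) (x : C) :
  dist x (inl g0 : C) =
  match x with inl g => dist g g0 | inr (g, _) => (dist g g0).+1 end.
Proof.
apply: (@dist_eq C (fun x => match x with
  | inl g => dist g g0 | inr (g, _) => (dist g g0).+1 end)).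
- exact: distxx.
- case=> [g|[g h]] [g'|[g' h']] /=.
  + by move=> /(dist_adj g0 G_connected).
  + by move=> /eqP <-; lia.
  + by move=> /eqP <-.
  + by move=> /andP[/eqP <- _].
- case=> [g|[g h]]; last by exists (inl g) => /=.
  move=> ne; have /(dist_descent G_connected)[g' gg' lt] : g != g0.
    by apply: contra_neq ne => ->.
  by exists (inl g').
Qed.

Definition copy (g : G) (A : {set C}) : {set H} := [set h | inr (g, h) \in A].

(** For the converse, [A] meets every copy because [H] has two vertices to tell apart; these
    vertices of [A] then separate all pairs not inside one copy. *)
Lemma resolving_corona (A : {set C}) : 1 < #|G| ->
  resolving A = [forall g, resolving (copy g A)].
Proof.
move=> G_ge2; have [cH le2 [h1 [h2 h12]]] := diam_Some2 H_diam.
apply/idP/forallP => [/resolvingP rA g|rA].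
  apply/resolvingP => x y xy.
  have [|[g'|[g' h]] zA] := rA (inr (g, x)) (inr (g, y)).
  - by apply: contra_neq xy => -[].
  - by rewrite !dist_corona_inl /= eqxx.
  - rewrite !dist_corona_inr; case: (g =P g') => [e|_]; last by rewrite eqxx.
    by exists h; rewrite // inE e.
have copy_n0 g : exists h, inr (g, h) \in A.
  have /resolvingP/(_ _ _ h12)[h] := rA g.
  by rewrite inE; exists h.
have sep (u v : G) : u != v -> 0 < dist u v.
  by rewrite lt0n dist_eq0.
(* Different copies are at distance at least 3, while a copy has diameter at most 2. *)
have far g g' h z : g != g' -> dist (inr (g', h) : C) (inr (g, z) : C) > 2.
  move=> ne; rewrite dist_corona_inr eq_sym (negbTE ne).
  by have /sep : g' != g by rewrite eq_sym.
have mixed g g' h : exists2 z, z \in A &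
    dist (inl g : C) z != dist (inr (g', h) : C) z.
  have [<-|gg'] := eqVneq g g'.
    (* To tell [g] from a vertex of its own copy, use a second copy: the latter vertex is one step
       farther from it. *)
    have [g2|none] := pickP (predC1 g); last first.
      by have := cardC1 g; rewrite (eq_card0 none); lia.
    rewrite /= eq_sym => /negbTE gg2.
    have [z zA] := copy_n0 g2; exists (inr (g2, z)) => //.
    by rewrite !dist_corona_inr gg2 neq_ltn leqnn.
  have [z zA] := copy_n0 g; exists (inr (g, z)) => //.
  by rewrite (dist_corona_inr _ _ (inl g)) distxx neq_ltn (ltnW (far _ _ _ _ gg')).
apply/resolvingP => -[g|[g h]] [g'|[g' h']] ne.
- have [z zA] := copy_n0 g; exists (inr (g, z)) => //.
  rewrite !dist_corona_inr distxx eqSS eq_sym.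
  by have /sep : g' != g by [apply: contra_neq ne => ->]; lia.
- exact: mixed.
- by have [z zA d] := mixed g' g h; exists z; rewrite // eq_sym.
- have [e|gg'] := eqVneq g g'.
    have hh' : h != h' by apply: contra_neq ne => ->; rewrite e.
    have /resolvingP/(_ _ _ hh')[z] := rA g; rewrite inE => zA d.
    by exists (inr (g, z)) => //; rewrite !dist_corona_inr -e eqxx.
  have [z zA] := copy_n0 g; exists (inr (g, z)) => //.
  rewrite (dist_corona_inr _ _ (inr (g, h))) eqxx neq_ltn.
  by rewrite (leq_ltn_trans (le2 h z) (far _ _ _ _ gg')).
Qed.

End Corona.

(** * The game on positions *)

Section Positions.
Variable X : sgraph.
Implicit Types (A B : {set X}) (k : nat).

(* [rwins k A B]: owning [A] against Spoiler's [B] and having the move, Resolver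
   can own a resolving set after at most [k] further moves; in [swins] Spoiler
   has the move. Spoiler may pass and players may reselect their own vertices:
   since this never helps, values are unchanged, and monotonicity in [A] and [B]
   becomes immediate. *)
Fixpoint rwins k A B : bool :=
  resolving A ||
  (if k is k'.+1 then
     [exists a, (a \notin B) && (rwins k' (a |: A) B &&
        [forall b, (b \notin a |: A) ==> rwins k' (a |: A) (b |: B)])]
   else false).

Definition swins k A B : bool :=
  rwins k A B && [forall b, (b \notin A) ==> rwins k A (b |: B)].

Definition wins P : nat -> {set X} -> {set X} -> bool :=
  if P is Resolver then rwins else swins.

Lemma swinsP k A B :
  reflect (rwins k A B /\ forall b, b \notin A -> rwins k A (b |: B))
          (swins k A B).
Proof.
apply: (iffP andP) => -[w v]; split=> //.
  by move=> b; move/forallP: v => /(_ b)/implyP.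
by apply/forallP => b; apply/implyP; apply: v.
Qed.

Lemma rwins0 A B : rwins 0 A B = resolving A.
Proof. by rewrite /= orbF. Qed.

Lemma rwinsSP k A B :
  reflect (resolving A \/ exists2 a, a \notin B & swins k (a |: A) B)
          (rwins k.+1 A B).
Proof.
apply: (iffP orP) => -[w|w]; try by left.
  by right; case/existsP: w => a /andP[]; exists a.
by right; apply/existsP; case: w => a aB w; exists a; rewrite aB.
Qed.

Lemma swins_rwins k A B : swins k A B -> rwins k A B.
Proof. by case/swinsP. Qed.

Lemma resolving_rwins k A B : resolving A -> rwins k A B.
Proof. by case: k => [|k] /= ->. Qed.

Lemma resolving_swins k A B : resolving A -> swins k A B.
Proof. by move=> w; apply/swinsP; split=> [|b _]; apply: resolving_rwins. Qed.

(** Reselection makes the induction go through: Resolver's winning move from [A] may already belong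
    to [A']. *)
Lemma rwins_mono k A B A' B' :
  A \subset A' -> B' \subset B -> rwins k A B -> rwins k A' B'.
Proof.
elim: k A B A' B' => [|k IH] A B A' B' sA sB.
  by rewrite !rwins0; apply: resolvingS.
case/rwinsSP => [/(resolvingS sA)|[a aB /swinsP[w v]]]; first exact: resolving_rwins.
apply/rwinsSP; right; exists a; first by apply: contra aB; apply: (subsetP sB).
apply/swinsP; split=> [|b bA]; first exact: IH (setUS _ sA) sB w.
apply: (IH _ _ _ _ (setUS _ sA) (setUS _ sB)); apply: v.
by apply: contra bA; apply/subsetP/setUS.
Qed.

Lemma swins_mono k A B A' B' :
  A \subset A' -> B' \subset B -> swins k A B -> swins k A' B'.
Proof.
move=> sA sB /swinsP[w v]; apply/swinsP; split=> [|b bA].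
  exact: rwins_mono sA sB w.
by apply: (rwins_mono sA (setUS _ sB)); apply: v; apply: contra bA; apply: (subsetP sA).
Qed.

Lemma rwinsW k k' A B : k <= k' -> rwins k A B -> rwins k' A B.
Proof.
elim: k' k A B => [|k' IH] [|k] A B //; rewrite ?rwins0.
  by move=> _; apply: resolving_rwins.
move=> le; case/rwinsSP => [|[a aB /swinsP[w v]]]; first exact: resolving_rwins.
apply/rwinsSP; right; exists a => //; apply/swinsP; split=> [|b bA].
  exact: IH w.
exact: (IH k) (v b bA).
Qed.

(** Recovers a genuine move: reselecting an owned vertex is a pass, and by monotonicity any free
    vertex does at least as well. *)
Lemma rwins_move k A B : rwins k.+1 A B -> A :|: B != setT ->
  exists2 a, a \notin A :|: B & swins k (a |: A) B.
Proof.
move=> w nT; have [a aAB] : exists a, a \notin A :|: B.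
  apply/existsP; rewrite -negb_forall; apply: contra nT => /forallP AB.
  by apply/eqP/setP => x; rewrite AB inE.
case/rwinsSP: w => [w|[c cB w]].
  by exists a => //; apply: resolving_swins; apply: resolvingS w; apply: subsetUr.
have [cA|cA] := boolP (c \in A).
  exists a => //; apply: swins_mono w => //.
  by rewrite (setUidPr _) ?sub1set // subsetUr.
by exists c; rewrite // inE negb_or cA.
Qed.

Lemma rwins_full k A B : A :|: B = setT -> rwins k A B -> resolving A.
Proof.
elim: k A => [|k IH] A AB; first by rewrite rwins0.
case/rwinsSP => // -[a aB /swins_rwins]; rewrite (setUidPr _); first exact: IH.
by rewrite sub1set; have := in_setT a; rewrite -AB inE (negbTE aB) orbF.
Qed.

End Positions.

(** * Strategies and positions *)

Section Strategies.
Variable X : sgraph.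
Implicit Types (P Q first : player) (s h : seq X) (k : nat).

Lemma to_move_rcons first h (x : X) :
  to_move first (rcons h x) = opponent (to_move first h).
Proof. by rewrite /to_move size_rcons. Qed.

Lemma selected_rcons P first h (x : X) :
  selected P first (rcons h x) =
  if same_player P (to_move first h) then rcons (selected P first h) x
  else selected P first h.
Proof.
elim: h first => [|y h IH] first //=; rewrite {}IH.
by rewrite /to_move /= -iterSr /=; do 2!case: ifP.
Qed.

Lemma mem_selected first h (x : X) :
  (x \in h) = (x \in selected Resolver first h) || (x \in selected Spoiler first h).
Proof.
elim: h first => [|y h IH] first //=; rewrite inE (IH (opponent first)).
by case: first; rewrite /= inE; [rewrite orbA | rewrite orbCA].
Qed.

Lemma size_selected P first h : size (selected P first h) <= size h.
Proof.
elim: h first => //= y h IH first.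
by case: ifP => _; [apply: IH | apply: leqW; apply: IH].
Qed.

Lemma follows_rcons P first (sigma : strategy X) h x :
  follows P first sigma h -> (to_move first h = P -> x = sigma h) ->
  follows P first sigma (rcons h x).
Proof.
move=> fh xP h' y /prefixP[t]; case/lastP: t => [|t z].
  by rewrite cats0 => /rcons_inj[<- <-].
rewrite -rcons_cat => /rcons_inj[eh _]; apply: fh.
by apply/prefixP; exists t.
Qed.

(* Vertices that Resolver selects after his [k]-th move do not count. *)
Definition resolver_part k first h : {set X} :=
  [set x in take k (selected Resolver first h)].

Definition spoiler_part first h : {set X} := [set x in selected Spoiler first h].

(** Invariant of a play. Truncated subtraction leaves budget 0 from the [k]-th move on, and then the
    invariant says that the first [k] vertices of Resolver already resolve. *)
Definition good k first h : bool :=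
  wins (to_move first h) (k - size (selected Resolver first h))
    (resolver_part k first h) (spoiler_part first h).

Lemma good_nil k first : good k first [::] = wins first k (@set0 X) set0.
Proof.
rewrite /good /resolver_part /spoiler_part /= subn0.
by congr wins; apply/setP => x; rewrite !inE.
Qed.

Lemma resolver_part_notin k first h (x : X) :
  x \notin h -> x \notin resolver_part k first h.
Proof.
by rewrite (mem_selected first) negb_or inE => /andP[+ _]; apply/contra/mem_take.
Qed.

Lemma part_full k first h :
    size (selected Resolver first h) <= k -> (forall x : X, x \in h) ->
  resolver_part k first h :|: spoiler_part first h = setT.
Proof.
move=> le full; apply/setP => x.
by rewrite !inE take_oversize // -mem_selected full.
Qed.

Lemma good_full k first h :
  (forall x : X, x \in h) -> good k first h -> resolving (resolver_part k first h).
Proof.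
move=> full gh; have {gh} : rwins (k - size (selected Resolver first h))
    (resolver_part k first h) (spoiler_part first h).
  by move: gh; rewrite /good; case: to_move => // /swins_rwins.
have [lt|le] := ltnP k (size (selected Resolver first h)).
  by rewrite (eqP (ltnW lt)) rwins0.
by apply: rwins_full; apply: part_full.
Qed.

Lemma good_spoiler_rcons k first h (x : X) : to_move first h = Spoiler ->
  good k first (rcons h x) =
  rwins (k - size (selected Resolver first h))
    (resolver_part k first h) (x |: spoiler_part first h).
Proof.
move=> mv; rewrite /good /resolver_part /spoiler_part.
rewrite to_move_rcons !selected_rcons mv /=.
by congr rwins; apply/setP => y; rewrite !inE mem_rcons inE.
Qed.

Lemma good_resolver_rcons k first h (x : X) : to_move first h = Resolver ->
  good k first (rcons h x) =
  if k - size (selected Resolver first h) is m.+1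
  then swins m (x |: resolver_part k first h) (spoiler_part first h)
  else swins 0 (resolver_part k first h) (spoiler_part first h).
Proof.
move=> mv; rewrite /good /resolver_part /spoiler_part.
rewrite to_move_rcons !selected_rcons mv /=.
rewrite size_rcons subnS; case e: (k - _) => [|m] /=.
  by rewrite -cats1 takel_cat // -subn_eq0 e.
have lt : size (selected Resolver first h) < k by rewrite -subn_gt0 e.
rewrite !take_oversize ?size_rcons ?(ltnW lt) //.
by congr swins; apply/setP => y; rewrite !inE mem_rcons inE.
Qed.

(** Backward induction on the number of unplayed vertices; the extra moves that [swins] grants
    Spoiler have to be shown harmless. *)
Lemma guarantees_good first (sigma : strategy X) k h :
    guarantees Resolver first sigma (resolver_won_within first k) ->
  uniq h -> follows Resolver first sigma h -> good k first h.
Proof.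
move=> [lsigma wsigma]; have [n] := ubnP (#|X| - size h).
elim: n h => // n IH h lt uh fh.
have [full|] := pselect (forall x, x \in h).
  have [W rW sW] := wsigma h (conj uh full) fh.
  have {W rW sW} r : resolving (resolver_part k first h).
    by apply: resolvingS rW; apply/subsetP => x /sW; rewrite inE.
  by rewrite /good; case: to_move; [apply: resolving_rwins | apply: resolving_swins].
move=> /existsNP[x0 /negP x0h].
have {}IH x : x \notin h -> (to_move first h = Resolver -> x = sigma h) ->
    good k first (rcons h x).
  move=> xh xsigma; have ux : uniq (rcons h x) by rewrite rcons_uniq xh.
  apply: IH => //; last exact: follows_rcons.
  have /card_uniqP ex := ux; have := max_card (mem (rcons h x)).
  by rewrite ex size_rcons; lia.
case mv: (to_move first h).
  have /IH/(_ (fun _ => erefl)) := lsigma h (ex_intro _ x0 x0h).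
  rewrite good_resolver_rcons // /good mv /=; case: (k - _) => [|m] w.
    exact: swins_rwins.
  apply/rwinsSP; right; exists (sigma h) => //.
  have := lsigma h (ex_intro _ x0 x0h).
  by rewrite (mem_selected first) negb_or inE => /andP[].
have {}IH x : x \notin h -> rwins (k - size (selected Resolver first h))
    (resolver_part k first h) (x |: spoiler_part first h).
  by move=> xh; rewrite -good_spoiler_rcons //; apply: IH => //; rewrite mv.
(* A pass is no better for Spoiler than the genuine move [x0]. *)
have w : rwins (k - size (selected Resolver first h))
    (resolver_part k first h) (spoiler_part first h).
  by apply: rwins_mono (IH _ x0h) => //; apply: subsetUr.
rewrite /good mv /=; apply/swinsP; split=> // b bR.
have [bS|bS] := boolP (b \in spoiler_part first h).
  by rewrite (setUidPr _) ?sub1set.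
have [bR'|bR'] := boolP (b \in selected Resolver first h); last first.
  by apply: IH; rewrite (mem_selected first) (negbTE bR'); move: bS; rewrite inE.
(* Here [b] was selected by Resolver after his [k]-th move, so the budget is 0 and Spoiler's part no
   longer matters. *)
have lt' : k < size (selected Resolver first h).
  by rewrite ltnNge; apply: contra bR => le; rewrite inE take_oversize.
by move: w; rewrite (eqP (ltnW lt')) !rwins0.
Qed.

Lemma good_guarantees first k : 0 < #|X| -> good k first [::] ->
  resolver_wins_within X first k.
Proof.
move=> /card_gt0P[x0 _] g0.
(* Preserve the invariant if possible; the fallback keeps [sigma] legal on all other histories. *)
pose sigma h :=
  if [pick x | (x \notin h) && good k first (rcons h x)] is Some x then x
  else odflt x0 [pick x | x \notin h].
exists sigma; split.
  move=> h [y yh]; rewrite /sigma; case: pickP => [x /andP[] //|_].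
  by case: pickP => // /(_ y); rewrite yh.
move=> s [us fulls] fs; exists (resolver_part k first s); last first.
  by move=> x; rewrite inE.
apply: good_full => //; have [h] : exists h, h = s by exists s.
move=> hs; rewrite -hs; have {hs} : prefix h s by rewrite hs prefix_refl.
elim/last_ind: h => [|h x IH] // hxs.
have {IH} gh : good k first h by apply: IH; apply: prefix_trans (prefix_rcons _ _) hxs.
have xh : x \notin h.
  have : uniq (rcons h x) by case/prefixP: hxs us => t ->; rewrite cat_uniq => /andP[].
  by rewrite rcons_uniq => /andP[].
case mv: (to_move first h); last first.
  rewrite good_spoiler_rcons //; move: gh; rewrite /good mv => /swinsP[_].
  by apply; apply: resolver_part_notin.
rewrite (fs _ _ hxs mv) /sigma; case: pickP => [y /andP[] //|none].
suff [a ah ga] : exists2 a, a \notin h & good k first (rcons h a).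
  by have := none a; rewrite ah ga.
(* With no budget left Resolver's part already resolves, so any move will do; otherwise [rwins_move]
   supplies one, [x] witnessing that the board is not full. *)
move: gh; rewrite {1}/good mv /=; case e: (k - _) => [|m] w.
  exists x => //; rewrite good_resolver_rcons // e.
  by apply: resolving_swins; rewrite rwins0 in w.
have ex : resolver_part k first h = [set y in selected Resolver first h].
  by rewrite /resolver_part take_oversize // ltnW // -subn_gt0 e.
have [|a aRS wa] := rwins_move w.
  apply: contraTneq xh => /setP/(_ x).
  by rewrite ex !inE -mem_selected => ->.
exists a; first by move: aRS; rewrite ex !inE -mem_selected.
by rewrite good_resolver_rcons // e.
Qed.

Lemma resolver_wins_withinP first k : 0 < #|X| ->
  resolver_wins_within X first k <-> wins first k (@set0 X) set0.
Proof.
move=> X0; rewrite -good_nil; split=> [[sigma gs]|]; last exact: good_guarantees.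
by apply: guarantees_good gs _ _ => // -[|? ?] ? /prefixP[].
Qed.

Lemma won_by_within first s :
  uniq s -> won_by Resolver first s <-> resolver_won_within first #|X| s.
Proof.
move=> /card_uniqP us; rewrite /resolver_won_within /= take_oversize //.
by apply: leq_trans (size_selected _ _ _) _; rewrite -us max_card.
Qed.

Lemma has_winning_strategyP first : 0 < #|X| ->
  has_winning_strategy X Resolver first <->
  exists k, wins first k (@set0 X) set0.
Proof.
move=> X0; split.
  (* A play has at most [#|X|] moves, so this bound is no restriction. *)
  move=> [sigma [ls ws]]; exists #|X|; apply/resolver_wins_withinP => //.
  exists sigma; split=> // s fs fo; apply/won_by_within; first by case: fs.
  exact: ws.
move=> [k /(resolver_wins_withinP _ _ X0)[sigma [ls ws]]].
exists sigma; split=> // s fs /(ws _ fs)[W rW sW].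
by exists W => // x /sW/mem_take.
Qed.

Lemma resolver_moves_spec first : 0 < #|X| ->
    has_winning_strategy X Resolver first ->
  wins first (resolver_moves X first) (@set0 X) set0 /\
  forall k, wins first k (@set0 X) set0 -> resolver_moves X first <= k.
Proof.
move=> X0 /(has_winning_strategyP _ X0)[k wk]; rewrite /resolver_moves.
case: pselect => [ex|[]]; last first.
  by exists k; apply/asboolP/resolver_wins_withinP.
case: ex_minnP => m /asboolP/(resolver_wins_withinP _ _ X0) wm min; split=> // j wj.
by apply: min; apply/asboolP/resolver_wins_withinP.
Qed.

End Strategies.

(** * The game on a corona product *)

Section CoronaGame.
Variables G H : sgraph.
Hypothesis G_connected : connected G.
Hypothesis G_ge2 : 1 < #|G|.
Hypothesis H_diam : diam H = Some 2.
Local Notation C := (corona G H).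
Implicit Types (A B : {set C}) (m : G -> nat).

Lemma eq_inr (g g' : G) (h h' : H) :
  ((inr (g, h) : C) == inr (g', h')) = ((g, h) == (g', h')).
Proof. by []. Qed.

Lemma copy_inl g g' A : copy g ((inl g' : C) |: A) = copy g A.
Proof. by apply/setP => h; rewrite !inE. Qed.

Lemma copy_inr g g' h A :
  copy g ((inr (g', h) : C) |: A) = if g == g' then h |: copy g A else copy g A.
Proof.
apply/setP => x; rewrite !inE eq_inr xpair_eqE.
by case: eqP => _; rewrite !inE.
Qed.

(* Resolver answers in the copy in which Spoiler has just played; when that
   copy is already won, or when Spoiler plays in [G], he makes a move in another
   copy instead, as if Spoiler had passed there. *)
Lemma swins_corona n m A B :
    \sum_g m g <= n -> (forall g, swins (m g) (copy g A) (copy g B)) ->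
  swins n A B.
Proof.
elim: n m A B => [|n IH] m A B.
  rewrite leqn0 sum_nat_eq0 => /forallP m0 w; apply: resolving_swins.
  rewrite resolving_corona //; apply/forallP => g.
  by rewrite -(rwins0 _ (copy g B)) -(eqP (m0 g)) swins_rwins.
move=> le w.
(* Resolver spends one move of a positive budget in copy [g0]; in the other copies Spoiler is to
   move. *)
have move_in m' A' B' g0 : 0 < m' g0 -> \sum_g m' g <= n.+1 ->
    rwins (m' g0) (copy g0 A') (copy g0 B') ->
    (forall g, g != g0 -> swins (m' g) (copy g A') (copy g B')) -> rwins n.+1 A' B'.
  case e: (m' g0) => [|p] // _ le' w0 w'.
  pose m1 g := if g == g0 then p else m' g.
  have le1 : \sum_g m1 g <= n.
    move: le'; rewrite (bigD1 g0) //= e addSn ltnS; apply: leq_trans.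
    rewrite (bigD1 g0) //= /m1 eqxx leq_add2l leq_sum // => g /negbTE -> //.
  have w1 g : g != g0 -> swins (m1 g) (copy g A') (copy g B').
    by move=> ne; rewrite /m1 (negbTE ne) w'.
  case/rwinsSP: w0 => [r|[a aB wa]].
    apply: (rwinsW (leqnSn n)); apply/swins_rwins/(IH m1) => // g.
    have [->|/w1 //] := eqVneq g g0; exact: resolving_swins.
  apply/rwinsSP; right; exists (inr (g0, a)); first by move: aB; rewrite inE.
  apply: (IH m1) => // g; rewrite copy_inr; case: eqP => [->|/eqP/w1 //].
  by rewrite /m1 eqxx.
(* A copy with budget 0 is already resolved, so Resolver moves in a copy with positive budget, if
   there is one. *)
have mover m' A' B' g0 : \sum_g m' g <= n.+1 ->
    rwins (m' g0) (copy g0 A') (copy g0 B') ->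
    (forall g, g != g0 -> swins (m' g) (copy g A') (copy g B')) -> rwins n.+1 A' B'.
  move=> le' w0 w'; have [|m0] := posnP (m' g0); last exact: move_in w0 w'.
  move=> m0; have r0 : resolving (copy g0 A') by move: w0; rewrite m0 rwins0.
  have {}w' g : swins (m' g) (copy g A') (copy g B').
    by have [->|/w'] := eqVneq g g0; first exact: resolving_swins.
  have [g1 m1|none] := pickP (fun g => 0 < m' g).
    by apply: (move_in m' A' B' g1) => //; apply: swins_rwins.
  apply: resolving_rwins; rewrite resolving_corona //; apply/forallP => g.
  have := swins_rwins (w' g); have := none g; rewrite lt0n => /negbFE/eqP ->.
  by rewrite rwins0.
have [g0 _] : exists g0 : G, true by have /card_gt1P[g0 _] := G_ge2; exists g0.
apply/swinsP; split=> [|[g|[g h]] bA].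
- by apply: (mover m _ _ g0) => //; apply: swins_rwins.
- apply: (mover m _ _ g0) => // [|g' _]; rewrite copy_inl //.
  exact: swins_rwins.
- apply: (mover m _ _ g) => // [|g' /negbTE ne]; rewrite copy_inr ?eqxx ?ne //.
  by case/swinsP: (w g) => _; apply; rewrite inE.
Qed.

(** Here [m g] counts the moves that copy [g] still demands. Spoiler's reply in the copy where
    Resolver moved lets that demand drop by at most one; a move in [G] lowers none, and she
    passes. *)
Lemma rwins_corona_lower n m A B :
    (forall g, 0 < m g -> ~~ rwins (m g).-1 (copy g A) (copy g B)) ->
  rwins n A B -> \sum_g m g <= n.
Proof.
elim: n m A B => [|n IH] m A B w.
  rewrite rwins0 resolving_corona // => /forallP r.
  rewrite leqn0 sum_nat_eq0; apply/forallP => g /=.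
  by apply: contraT; rewrite -lt0n => /w; rewrite resolving_rwins.
case/rwinsSP => [r|[[g|[g h]] aB /swinsP[wp wb]]].
- apply: leqW; apply: IH w _; exact: resolving_rwins.
- by apply: leqW; apply: IH wp => g' /w; rewrite copy_inl.
have hB : h \notin copy g B by rewrite inE.
pose m1 g' := if g' == g then (m g).-1 else m g'.
have {aB} le : \sum_g' m g' <= (\sum_g' m1 g').+1.
  rewrite (bigD1 g) //= [in X in _ <= X](bigD1 g) //= /m1 eqxx.
  rewrite -addSn leq_add ?leqSpred //.
  by rewrite leq_sum // => g' /negbTE ->.
apply: leq_trans le _; rewrite ltnS.
(* Induction after a reply of Spoiler that changes only copy [g]. *)
have same B' : (forall g', g' != g -> copy g' B' = copy g' B) ->
    (0 < (m g).-1 -> ~~ rwins (m g).-2 (h |: copy g A) (copy g B')) ->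
    rwins n ((inr (g, h) : C) |: A) B' -> \sum_g' m1 g' <= n.
  move=> eB w0; apply: IH => g'; rewrite copy_inr /m1.
  by case: eqP => [->|/eqP/eB ->]; [apply: w0 | apply: w].
(* If the remaining demand of copy [g] is 0, Spoiler passes. *)
have [m1g|] := leqP (m g).-1 0; first by apply: (same B) => //; rewrite lt0n -leqn0 m1g.
case e: (m g) => [|[|p]] //= _; have := w g; rewrite e => /(_ isT) /= /rwinsSP.
(* Failure of [swins] yields the reply: a pass if that suffices, otherwise a vertex [b] of the same
   copy. *)
move=> nw; have : ~~ swins p (h |: copy g A) (copy g B).
  by apply/negP => wS; apply: nw; right; exists h.
rewrite negb_and => /orP[nwp|]; first by apply: (same B) => //; rewrite e.
rewrite negb_forall => /existsP[b]; rewrite negb_imply => /andP[bA nwb].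
apply: (same ((inr (g, b) : C) |: B)).
- by move=> g' /negbTE ne; rewrite copy_inr ne.
- by rewrite e copy_inr eqxx.
- by apply: wb; move: bA; rewrite !inE eq_inr xpair_eqE eqxx.
Qed.

Lemma copy0 g : copy g (@set0 C) = set0.
Proof. by apply/setP => h; rewrite !inE. Qed.

End CoronaGame.

Theorem proposition4p2 (G H : sgraph)
    (G_connected : connected G) (G_ge2 : 2 <= #|G|)
    (H_diam : diam H = Some 2) (H_outcome : has_outcome H outcome_R) :
  [/\ has_outcome (corona G H) outcome_R,
      RMB (corona G H) <= RMB' (corona G H),
      RMB' (corona G H) <= #|G| * RMB' H
    & RMB H = RMB' H ->
      RMB (corona G H) = RMB' (corona G H) /\
      RMB' (corona G H) = #|G| * RMB H].
Proof.
have [g0 _] : exists g0 : G, true by have /card_gt1P[g0 _] := G_ge2; exists g0.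
have H0 : 0 < #|H|.
  by have [_ _ [h _]] := diam_Some2 H_diam; apply/card_gt0P; exists h.
have C0 : 0 < #|corona G H| by apply/card_gt0P; exists (inl g0).
have [wS minS] := resolver_moves_spec H0 (H_outcome Spoiler).
have [_ minR] := resolver_moves_spec H0 (H_outcome Resolver).
have wC : swins (#|G| * RMB' H) (@set0 (corona G H)) set0.
  apply: (@swins_corona _ _ _ _ _ _ (fun _ => RMB' H)) => //.
    by rewrite sum_nat_const.
  by move=> g; rewrite !copy0.
have oC : has_outcome (corona G H) outcome_R.
  case; apply/has_winning_strategyP => //; exists (#|G| * RMB' H) => //.
  exact: swins_rwins.
have [wCS minCS] := resolver_moves_spec C0 (oC Spoiler).
have [wCR minCR] := resolver_moves_spec C0 (oC Resolver).
have upper : RMB' (corona G H) <= #|G| * RMB' H by apply: minCS.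
(* Spoiler may pass, so a bound for the S-game also holds for the R-game. *)
have RS : RMB (corona G H) <= RMB' (corona G H) by apply/minCR/swins_rwins.
have lower : #|G| * RMB H <= RMB (corona G H).
  rewrite -sum_nat_const.
  (* Each copy demands [RMB H] moves: by minimality its predecessor does not suffice. *)
  apply: (@rwins_corona_lower _ _ _ _ _ _ (fun _ => RMB H)) wCR => // g lt.
  rewrite !copy0; apply/negP => /minR; rewrite -/(RMB H).
  by move: lt; case: (RMB H) => // r _; rewrite ltnn.
(* The hypothesis [e] makes the two ends of the chain [lower], [RS], [upper] coincide. *)
split=> // e; rewrite -e in upper.
split; apply/eqP; rewrite eqn_leq; first by rewrite RS (leq_trans upper lower).
by rewrite upper (leq_trans lower RS).
Qed.
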